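(* Let $\mathcal{H}$ be a real Hilbert space. For every $\sigma>0$ the Gaussian kernel $G_{\sigma}:\mathcal{H}\times\mathcal{H}\to\mathbb{R}$, $G_{\sigma}(x,y)=e^{-\sigma\|x-y\|^{2}}$, is strictly positive definite (SPD) and universal.
   Context: A kernel $K:X\times X\to\mathbb{C}$ on a set $X$ is positive definite if $\sum_{\mu,\nu=1}^{n}c_{\mu}\overline{c_{\nu}}K(x_{\mu},x_{\nu})\ge 0$ for all finitely many distinct points $x_{1},\dots,x_{n}\in X$ and scalars $c_{1},\dots,c_{n}\in\mathbb{C}$; it is strictly positive definite (SPD) if moreover this double sum vanishes only when all $c_{\mu}=0$. The reproducing kernel Hilbert space (RKHS) $\mathcal{H}_{K}$ of a positive definite kernel $K$ is the Hilbert space of functions $F:X\to\mathbb{C}$ that contains $K_{y}:=K(\cdot,y)$ for every $y\in X$, satisfies $\langle F,K_{y}\rangle_{\mathcal{H}_{K}}=F(y)$ for all $F\in\mathcal{H}_{K}$, $y\in X$, and in which $\mathrm{span}\{K_{y}:y\in X\}$ is dense. If $X$ is a Hausdorff space, a positive definite kernel $K$ is universal if $\mathcal{H}_{K}\subset C(X)$ (continuous complex-valued functions) and for every compact $\mathcal{C}\subset X$, every continuous $g:\mathcal{C}\to\mathbb{C}$ and every $\epsilon>0$ there is $f\in\mathcal{H}_{K}$ with $\sup_{x\in\mathcal{C}}|f(x)-g(x)|<\epsilon$. The Hilbert space $\mathcal{H}$ carries its norm topology and is not assumed separable. *)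

(* Defs.v *)
From HB Require Import structures.
From mathcomp Require Import all_boot all_order all_algebra sesquilinear.
From mathcomp Require Import complex.
From mathcomp Require Import all_classical all_reals all_analysis.

Set Implicit Arguments.
Unset Strict Implicit.
Unset Printing Implicit Defensive.

Import Order.TTheory GRing.Theory Num.Theory.
Import numFieldNormedType.Exports.

Local Open Scope classical_set_scope.
Local Open Scope ring_scope.
Local Open Scope complex_scope.

(* A Hilbert space over K is a completeNormedModType over K together with an
   inner product (linear in the first argument, conjugate-linear in the second)
   inducing its norm. *)
Definition induces_norm (K : numFieldType) (theta : K -> K)
    (V : normedModType K) (dot : {dot V for theta}) :=
  forall v : V, dot v v = `|v| ^+ 2.

Definition linear_span (K : numFieldType) (V : normedModType K) (A : set V)
    : set V :=
  [set v | exists n (c : 'I_n -> K) (a : 'I_n -> V),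
     (forall i, A (a i)) /\ v = \sum_(i < n) c i *: a i].

Section Kernels.
Variable R : realType.
Local Notation C := R[i].

Definition kernel_form (X : Type) (K : X -> X -> C) n
    (x : 'I_n -> X) (c : 'I_n -> C) : C :=
  \sum_(mu < n) \sum_(nu < n) c mu * (c nu)^*%C * K (x mu) (x nu).

(* 0 <= z in R[i] means that z is real and nonnegative. *)
Definition positive_definite (X : Type) (K : X -> X -> C) :=
  forall n (x : 'I_n -> X) (c : 'I_n -> C),
    injective x -> 0 <= kernel_form K x c.

Definition strictly_positive_definite (X : Type) (K : X -> X -> C) :=
  positive_definite K /\
  forall n (x : 'I_n -> X) (c : 'I_n -> C),
    injective x -> kernel_form K x c = 0 -> forall mu, c mu = 0.

(* A Hilbert space of functions on X is a complex Hilbert space V with an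
   injective linear map ev : V -> (X -> C); F : V stands for the function
   ev F, and the operations on functions are the pointwise ones. *)
Definition is_rkhs (X : Type) (K : X -> X -> C)
    (V : completeNormedModType C) (dot : {dot V for @conjc R})
    (ev : V -> X -> C) :=
  [/\ induces_norm dot,
      (forall (a : C) (F G : V) (x : X), ev (a *: F + G) x = a * ev F x + ev G x)
      /\ injective ev &
      exists k : X -> V,
        [/\ forall y, ev (k y) = K^~ y,
            forall (F : V) (y : X), dot F (k y) = ev F y &
            dense (linear_span (range k))]].

(* The space H_K is unique up to isometry, so that the conditions on it are
   required of each of its presentations, of which there must be one.
   Hausdorffness of X is not needed to state the definition, hence not assumed.
   C carries its norm topology, which the library attaches to C^o. *)
Definition universal (X : topologicalType) (K : X -> X -> C) :=
  [/\ positive_definite K,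
      exists (V : completeNormedModType C) (dot : {dot V for @conjc R})
        (ev : V -> X -> C), is_rkhs K dot ev &
      forall (V : completeNormedModType C) (dot : {dot V for @conjc R})
        (ev : V -> X -> C), is_rkhs K dot ev ->
      (forall F : V, continuous (ev F : X -> C^o)) /\
      (forall (A : set X) (g : X -> C^o) (eps : R),
         compact A -> {within A, continuous g} -> 0 < eps ->
         exists F : V,
           (ereal_sup [set (Normc.normc (ev F x - g x))%:E | x in A]
            < eps%:E)%E)].

Definition gaussian (H : normedModType R) (sigma : R) (x y : H) : R :=
  expR (- sigma * `|x - y| ^+ 2).

End Kernels.

(* Main.v *)
(* Gram matrices of <x,y> are positive semidefinite, hence by the Schur product
   so are those of <x,y>^m, of exp (2 sigma <x,y>), and of
   G(x,y) = w(x) w(y) exp (2 sigma <x,y>) with w(x) = exp (- sigma |x|^2).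
   The span of the functions exp <.,z> is an algebra, because
   exp <.,y> exp <.,z> = exp <.,y+z>, and it separates points.  Inside it one can
   interpolate on finite sets, which yields strictness; and Stone-Weierstrass,
   applied to g / w on the compact set, yields universality, since w exp <.,z> is
   a multiple of G(.,z / (2 sigma)).
   The reproducing kernel Hilbert space is realized as the space of functions f
   that define bounded functionals (c_i, x_i) |-> sum c_i f(x_i) on formal
   combinations of points, seminormed by the kernel. *)
Require Import Defs.
From HB Require Import structures.
From mathcomp Require Import all_boot all_order all_algebra sesquilinear.
From mathcomp Require Import finmap complex ring lra.
From mathcomp Require Import all_classical all_reals all_analysis.

Set Implicit Arguments.
Unset Strict Implicit.
Unset Printing Implicit Defensive.

Import Order.TTheory GRing.Theory Num.Theory.
Import numFieldNormedType.Exports.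

Local Open Scope classical_set_scope.
Local Open Scope ring_scope.

(** * Positive semidefiniteness *)

Section RealDot.
Variables (R : realType) (H : lmodType R) (dot : {dot H for idfun}).

Lemma dot_sym x y : dot x y = dot y x.
Proof. by rewrite hermitian_subproof expr0 mul1r. Qed.

Lemma dotDl x y z : dot (x + y) z = dot x z + dot y z.
Proof. by rewrite linearDl. Qed.

Lemma dotDr x y z : dot x (y + z) = dot x y + dot x z.
Proof. by rewrite linearDr. Qed.

Lemma dotBl x y z : dot (x - y) z = dot x z - dot y z.
Proof. by rewrite linearBl. Qed.

Lemma dotBr x y z : dot x (y - z) = dot x y - dot x z.
Proof. by rewrite linearBr. Qed.

Lemma dotZl a x y : dot (a *: x) y = a * dot x y.
Proof. by rewrite linearZl_LR. Qed.

Lemma dotZr a x y : dot x (a *: y) = a * dot x y.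
Proof. by rewrite linearZr_LR. Qed.

Definition psd n (M : 'I_n -> 'I_n -> R) :=
  forall a : 'I_n -> R, 0 <= \sum_i \sum_j a i * a j * M i j.

(* Projecting off one of the vectors splits the Gram matrix into a rank-one
   matrix and a Gram matrix with fewer nonzero vectors. *)
Lemma psd_mul_gram n (M : 'I_n -> 'I_n -> R) (x : 'I_n -> H) :
  psd M -> psd (fun i j => M i j * dot (x i) (x j)).
Proof.
move=> Mpsd.
have [k] := ubnP #|[pred i | x i != 0]|.
elim: k x => // k IH x; rewrite ltnS => xk a.
have [i0 xi0|x0] := pickP [pred i | x i != 0]; last first.
  rewrite big1// => i _; rewrite big1// => j _.
  by move: (x0 i) => /= /negbFE/eqP ->; rewrite linear0l !mulr0.
move: xi0 => /= xi0; have d0 := @neq0_dnorm_gt0 _ _ _ dot _ xi0.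
set d := dot (x i0) (x i0) in d0.
pose t i := dot (x i) (x i0); pose y i : H := x i - (t i / d) *: x i0.
have yE i j : dot (x i) (x j) = dot (y i) (y j) + t i * t j / d.
  rewrite /y !(dotBl, dotBr) !(dotZl, dotZr) -/d (dot_sym (x i0) (x j)) -!/(t _).
  by field; rewrite gt_eqF.
have yk : (#|[pred i | y i != 0%R]| < k)%N.
  apply: leq_trans xk; apply: proper_card; apply/properP; split.
    apply/fintype.subsetP => i; rewrite !inE; apply: contraNN => /eqP xi.
    by rewrite /y /t xi linear0l mul0r scale0r subr0.
  exists i0; rewrite inE// /y /t -/d divff ?gt_eqF// scale1r subrr eqxx//.
(* The rank-one part [t i * t j / d] is absorbed into the coefficients, so that [Mpsd] applies at
   [a i * t i]. *)
have -> : \sum_i \sum_j a i * a j * (M i j * dot (x i) (x j)) =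
  \sum_i \sum_j a i * a j * (M i j * dot (y i) (y j)) +
  (\sum_i \sum_j (a i * t i) * (a j * t j) * M i j) / d.
  rewrite mulr_suml -big_split/=; apply: eq_bigr => i _.
  rewrite mulr_suml -big_split/=; apply: eq_bigr => j _.
  by rewrite yE; field; rewrite gt_eqF.
by rewrite addr_ge0 ?IH// divr_ge0 ?Mpsd// ltW.
Qed.

(** The zeroth power is the all-ones matrix, whose form is the square of [\sum_i a i]; each further
    power is a Schur product with the Gram matrix. *)
Lemma psd_gram_exp n (x : 'I_n -> H) m :
  psd (fun i j => dot (x i) (x j) ^+ m).
Proof.
elim: m => [a|m IH].
  under eq_bigr do under eq_bigr do rewrite expr0 mulr1.
  under eq_bigr do rewrite -mulr_sumr.
  by rewrite -mulr_suml -expr2 sqr_ge0.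
move=> a; have := psd_mul_gram x IH a.
by under eq_bigr do under eq_bigr do rewrite -exprSr.
Qed.

(** The form is a limit of the forms of the partial exponential series, which are nonnegative
    combinations of Schur powers. *)
Lemma psd_expR_gram n (x : 'I_n -> H) :
  psd (fun i j => expR (dot (x i) (x j))).
Proof.
move=> a.
pose u := fun N => \sum_i \sum_j a i * a j *
  series (exp_coeff (dot (x i) (x j))) N.
have ucvg : u @ \oo --> \sum_i \sum_j a i * a j * expR (dot (x i) (x j)).
  apply: cvg_big => [|i _]; first exact: add_continuous.
  apply: cvg_big => [|j _]; first exact: add_continuous.
  by apply: cvgMl_tmp; exact: is_cvg_series_exp_coeff.
rewrite -(cvg_lim _ ucvg)//; apply: limr_ge; first by apply/cvg_ex; eexists; exact: ucvg.
apply: nearW => N; rewrite /u.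
have -> : \sum_i \sum_j a i * a j * series (exp_coeff (dot (x i) (x j))) N =
  \sum_(0 <= m < N) (\sum_i \sum_j a i * a j * dot (x i) (x j) ^+ m) / m`!%:R.
  under [RHS]eq_bigr do rewrite mulr_suml.
  rewrite [RHS]exchange_big/=; apply: eq_bigr => i _.
  under [RHS]eq_bigr do rewrite mulr_suml.
  rewrite [RHS]exchange_big/=; apply: eq_bigr => j _.
  rewrite /series/= mulr_sumr; apply: eq_bigr => m _.
  by rewrite /exp_coeff/= mulrA.
by apply: sumr_ge0 => m _; rewrite divr_ge0 ?ler0n//; exact: psd_gram_exp.
Qed.

End RealDot.

(** * The Stone-Weierstrass theorem *)

Section StoneWeierstrass.
Variables (R : realType) (T : ptopologicalType).
Implicit Types (f g h : T -> R) (A : set T) (S : set (T -> R)).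

(** The sets where [F t < g] cover [A]; the minimum of the [F t] over a finite subcover stays below
    [g] on all of [A]. *)
Lemma compact_exists_lt A (L : set (T -> R)) g :
  compact A -> L !=set0 -> (forall f, L f -> continuous f) ->
  (forall f h, L f -> L h -> L (f \min h)) ->
  continuous g -> (forall t, A t -> exists2 f, L f & f t < g t) ->
  exists2 f, L f & forall x, A x -> f x < g x.
Proof.
rewrite compact_cover => cA [f0 Lf0] Lc Lmin gc Lg.
(* Outside [A] the choice function takes the dummy value [f0], which also starts the finite minimum
   below. *)
have /choice[F FP] t : exists f, L f /\ (A t -> f t < g t).
  have [At|nAt] := pselect (A t); last by exists f0.
  by have [f Lf ft] := Lg t At; exists f.
pose O t := [set x | F t x < g x].
have Oo t : A t -> open (O t).
  move=> _; have -> : O t = (g \- F t) @^-1` [set y | 0 < y].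
    by apply/seteqP; split => x /=; rewrite subr_gt0.
  apply: open_comp; last exact: open_gt.
  move=> x _; apply: cvgB; first exact: gc.
  by apply: Lc; have [] := FP t.
have [|D _ Dcov] := cA _ A O Oo.
  by move=> t At; exists t => //; have [_] := FP t; exact.
have {Dcov} Dcov x : A x -> exists2 t, t \in enum_fset D & F t x < g x.
  by move=> /Dcov[t /= tD]; exists t.
suff [f Lf fle] : exists2 f, L f &
    forall t x, t \in enum_fset D -> f x <= F t x.
  by exists f => // x /Dcov[t tD]; exact: le_lt_trans (fle _ _ tD).
elim: (enum_fset D) => [|t s [f Lf fle]]; first by exists f0.
exists (F t \min f); first by apply: Lmin => //; have [] := FP t.
move=> u x; rewrite inE => /predU1P[->|us] /=; first by rewrite ge_min lexx.
by rewrite ge_min fle ?orbT.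
Qed.

Definition function_algebra S :=
  [/\ forall c : R, S (cst c),
      forall f g, S f -> S g -> S (f \+ g) &
      forall f g, S f -> S g -> S (f \* g)].

Definition uniform_closure A S : set (T -> R) :=
  [set f | continuous f /\ forall eps : R, 0 < eps ->
     exists2 h, S h & forall x, A x -> `|f x - h x| < eps].

Lemma sub_uniform_closure A S f :
  S f -> continuous f -> uniform_closure A S f.
Proof.
by move=> Sf cf; split=> // e e0; exists f => // x _; rewrite subrr normr0.
Qed.

(* Iterates of p |-> p + (t^2 - p^2) / 2 from 0: polynomials in t that increase
   to |t|, uniformly on [-1, 1]. *)
Fixpoint abs_approx n (t : R) : R :=
  if n is m.+1 then
    abs_approx m t + (t ^+ 2 - abs_approx m t ^+ 2) / 2
  else 0.

(** One step multiplies the gap to u = [|t|] by 1 - (u + p) / 2, at most 1 - u / 2. Since (1 -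
    u/2)(1 + (n+1)u/2) is at most 1 + nu/2, a gap bound of the form u / (1 + nu/2) is inherited. *)
Lemma abs_approx_bounds n (t : R) : `|t| <= 1 ->
  [/\ 0 <= abs_approx n t, abs_approx n t <= `|t| &
      (`|t| - abs_approx n t) * (1 + n%:R * (`|t| / 2)) <= `|t|].
Proof.
move=> t1; elim: n => [|n [IH0 IH1 IH2]] /=.
  by rewrite subr0 mul0r addr0 mulr1.
have u0 := normr_ge0 t; rewrite -(real_normK (num_real t)).
have -> : n.+1%:R = n%:R + 1 :> R by rewrite natr1.
set u : R := `|t| in t1 IH1 IH2 u0 *.
set p := abs_approx n t in IH0 IH1 IH2 *.
have n0 : (0 : R) <= n%:R by rewrite ler0n.
set N : R := n%:R in IH2 n0 *.
have step : u - (p + (u ^+ 2 - p ^+ 2) / 2) = (u - p) * (1 - (u + p) / 2).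
  by field.
have up : 0 <= u - p by rewrite subr_ge0.
have q0 : 0 <= 1 - (u + p) / 2 by lra.
have s0 : 0 <= u ^+ 2 - p ^+ 2 by rewrite subr_sqr mulr_ge0// addr_ge0.
split.
- by rewrite addr_ge0// divr_ge0.
- by rewrite -subr_ge0 step mulr_ge0.
rewrite step.
apply: le_trans IH2.
have h1 : (1 - (u + p) / 2) * (1 + (N + 1) * (u / 2)) <=
          (1 - u / 2) * (1 + (N + 1) * (u / 2)).
  by apply: ler_wpM2r; nra.
have h2 : (1 - u / 2) * (1 + (N + 1) * (u / 2)) <= 1 + N * (u / 2) by nra.
rewrite -[leLHS]mulrA; apply: ler_wpM2l => //; exact: le_trans h1 h2.
Qed.

Lemma abs_approx_lt n (t : R) : `|t| <= 1 -> `| `|t| - abs_approx n.+1 t | <= 2 / n.+1%:R.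
Proof.
move=> t1; have [p0 p1 p2] := abs_approx_bounds n.+1 t1.
rewrite [leLHS]ger0_norm ?subr_ge0// ler_pdivlMr ?ltr0n//.
move: p0 p1 (normr_ge0 t) (ltr0n R n.+1) p2.
move: (abs_approx _ _) `|t| n.+1%:R => p u N p0 p1 u0 N0 h.
(* The rate yields the claim multiplied by [u], which can be cancelled unless it is 0; in that case
   [p] is 0 as well. *)
have [u00|uN0] := eqVneq u 0.
  by have -> : u - p = 0 by [lra]; rewrite mul0r.
have up : 0 < u by rewrite lt_def uN0.
have : (u - p) * N * u <= 2 * u by nra.
by rewrite ler_pM2r.
Qed.

Lemma function_algebra_sub S f g :
  function_algebra S -> S f -> S g -> S (f \- g).
Proof.
move=> [Sc SD SM] Sf Sg.
have -> : f \- g = f \+ (cst (-1) \* g).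
  by apply/funext => x /=; rewrite mulN1r.
by apply: (SD) => //; exact: SM.
Qed.

Lemma function_algebra_abs_approx S f n :
  function_algebra S -> S f -> S (abs_approx n \o f).
Proof.
move=> Salg Sf; have [Sc SD SM] := Salg.
elim: n => [|n IH]; first exact: Sc.
have -> : abs_approx n.+1 \o f = (abs_approx n \o f) \+
    (((f \* f) \- ((abs_approx n \o f) \* (abs_approx n \o f))) \* cst (2^-1)).
  by apply/funext => x /=; rewrite !expr2.
by apply: (SD) => //; apply: (SM) => //; apply: function_algebra_sub => //; exact: SM.
Qed.

Lemma compact_bounded_fun A f : compact A -> continuous f ->
  exists2 M : R, 0 < M & forall x, A x -> `|f x| <= M.
Proof.
move=> cA cf.
have /compact_bounded[M [_ Mb]] : compact (f @` A).
  by apply: continuous_compact => //; exact: continuous_subspaceT.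
exists (`|M| + 1) => [|x Ax]; first by rewrite ltr_wpDl.
by apply: (Mb (`|M| + 1)); [rewrite (le_lt_trans (ler_norm M))// ltrDl|exists x].
Qed.

Section Lattice.
Variables (A : set T) (S : set (T -> R)).
Hypotheses (cA : compact A) (Salg : function_algebra S).
Hypothesis Scont : forall f, S f -> continuous f.
Local Notation L := (uniform_closure A S).

(** An approximant [h] of [f] is bounded on [A]; divided by its bound [M] it takes values in
    [-1, 1], where [abs_approx] converges uniformly. *)
Lemma uniform_closure_abs f : L f -> L (fun x => `|f x|).
Proof.
move=> [cf fS]; split.
  by move=> x; apply: (@cvg_norm _ R^o); exact: cf.
move=> e e0; have e20 : 0 < e / 2 by rewrite divr_gt0.
have [h Sh fh] := fS _ e20.
have [M M0 hM] := compact_bounded_fun cA (Scont Sh).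
have [Sc SD SM] := Salg.
(* Undoing the rescaling multiplies the error [2 / n.+1%:R] by [M]. *)
have [n nM] : exists n, M * (2 / n.+1%:R) < e / 2.
    have e'0 : 0 < e / (4 * M) by rewrite divr_gt0 ?mulr_gt0.
    near \oo => n; exists n.
    have : n.+1%:R^-1 < e / (4 * M) by near: n; exact: (near_infty_natSinv_lt (PosNum e'0)).
    rewrite ltr_pdivlMr ?mulr_gt0// => nM.
    have -> : M * (2 / n.+1%:R) = (n.+1%:R^-1 * (4 * M)) / 2 by field.
    by rewrite ltr_pM2r.
exists (cst M \* (abs_approx n.+1 \o (cst M^-1 \* h))).
  by apply: (SM) => //; apply: function_algebra_abs_approx => //; exact: SM.
move=> x Ax /=.
have hx : `|M^-1 * h x| <= 1.
  by rewrite normrM gtr0_norm ?invr_gt0// mulrC ler_pdivrMr// mul1r hM.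
have := abs_approx_lt n hx; set p := abs_approx _ _ => hp.
have -> : `|f x| - M * p = (`|f x| - `|h x|) + M * (`|M^-1 * h x| - p).
  by rewrite mulrBr normrM gtr0_norm ?invr_gt0// mulVKf ?gt_eqF//; ring.
apply: le_lt_trans (ler_normD _ _) _.
rewrite [e]splitr ltr_leD//.
  by apply: le_lt_trans (ler_dist_dist _ _) _; exact: fh.
by apply: le_trans (ltW nM); rewrite normrM gtr0_norm// ler_pM2l.
Unshelve. all: by end_near. Qed.

Lemma uniform_closureD f g : L f -> L g -> L (f \+ g).
Proof.
move=> [cf fS] [cg gS]; split.
  by move=> x; apply: cvgD; [exact: cf|exact: cg].
move=> e e0; have e20 : 0 < e / 2 by rewrite divr_gt0.
have [h Sh fh] := fS _ e20; have [k Sk gk] := gS _ e20.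
have [_ SD _] := Salg.
exists (h \+ k) => [|x Ax /=]; first exact: SD.
rewrite opprD addrACA (le_lt_trans (ler_normD _ _))// [e]splitr ltrD//.
- exact: fh.
- exact: gk.
Qed.

Lemma uniform_closureZ (c : R) f : L f -> L (cst c \* f).
Proof.
move=> [cf fS]; split; first by move=> x; apply: cvgMl_tmp; exact: cf.
move=> e e0.
(* Adding 1 keeps the divisor positive when [c] is 0. *)
have c0 : 0 < `|c| + 1 by rewrite ltr_wpDl.
have [h Sh fh] := fS _ (divr_gt0 e0 c0).
have [Sc SD SM] := Salg.
exists (cst c \* h) => [|x Ax /=]; first exact: SM.
rewrite -mulrBr normrM.
apply: (@le_lt_trans _ _ ((`|c| + 1) * `|f x - h x|)).
  by rewrite ler_wpM2r// lerDl.
by rewrite mulrC -ltr_pdivlMr// fh.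
Qed.

Lemma uniform_closureB f g : L f -> L g -> L (f \- g).
Proof.
move=> Lf Lg; have -> : f \- g = f \+ (cst (-1) \* g).
  by apply/funext => x /=; rewrite mulN1r.
by apply: uniform_closureD => //; exact: uniform_closureZ.
Qed.

Lemma uniform_closure_min f g : L f -> L g -> L (f \min g).
Proof.
move=> Lf Lg.
have -> : f \min g = cst 2^-1 \* ((f \+ g) \- (fun x => `|(f \- g) x|)).
  apply/funext => x /=.
  case: (leP (f x) (g x)) => fg.
    by rewrite ler0_norm ?subr_le0//; field.
  by rewrite gtr0_norm ?subr_gt0//; field.
apply/uniform_closureZ/uniform_closureB; first exact: uniform_closureD.
exact/uniform_closure_abs/uniform_closureB.
Qed.

(** Distinct points are served by an affine function of a separating [h], equal points by a
    constant. *)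
Lemma separating_interpolation (s t : T) (a b : R) :
  (forall x y, A x -> A y -> x <> y -> exists2 f, S f & f x <> f y) ->
  A s -> A t -> (s = t -> a = b) -> exists2 f, S f & f s = a /\ f t = b.
Proof.
move=> sep As At ab; have [Sc SD SM] := Salg.
have [/[dup] st /ab <-|st] := pselect (s = t); first by exists (cst a).
have [h Sh /eqP hst] := sep s t As At st.
exists (cst a \+ (cst ((b - a) / (h t - h s)) \* (h \+ cst (- h s)))).
  by apply: (SD) => //; apply: (SM) => //; exact: SD.
have d0 : h t - h s != 0 by rewrite subr_eq0 eq_sym.
by split => /=; [rewrite subrr mulr0 addr0|field].
Qed.

(** Two compactness passes in the lattice [L]. The first fixes [s] and finds a function equal to [g]
    at [s] and below [g + e / 2] on [A]; the second combines these over [s] into one that is also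
    above [g - e / 2]. *)
Lemma stone_weierstrass g :
  (forall x y, A x -> A y -> x <> y -> exists2 f, S f & f x <> f y) ->
  continuous g -> forall eps : R, 0 < eps ->
  exists2 f, S f & forall x, A x -> `|f x - g x| < eps.
Proof.
move=> sep cg e e0; have e20 : 0 < e / 2 by rewrite divr_gt0.
have [Sc SD SM] := Salg.
have LS f : S f -> L f by move=> Sf; apply: sub_uniform_closure => //; exact: Scont.
have gDc (d : R) : continuous (g \+ cst d).
  by move=> x; apply: cvgD; [exact: cg|exact: cvg_cst].
have above s : A s -> exists2 f, L f /\ f s = g s & forall x, A x -> f x < g x + e / 2.
  move=> As.
  apply: (@compact_exists_lt A [set f | L f /\ f s = g s] (g \+ cst (e / 2))) => //.
  - by exists (cst (g s)); split => //; exact: LS.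
  - by move=> f [[]].
  - move=> f h [Lf fs] [Lh hs]; split; first exact: uniform_closure_min.
    by rewrite /= fs hs minxx.
  - move=> t At.
    have [|f Sf [fs ft]] := separating_interpolation (a := g s) (b := g t) sep As At.
      by move=> ->.
    by exists f; [split => //; exact: LS|rewrite /= ft ltrDl].
(* The second pass needs maxima; they are taken as minima of the negated functions, with
   [- g + e / 2] as the upper barrier. *)
have [|f|f h [Lf fl] [Lh hl]|x|s As|f /= [Lf fl] fg] :=
    @compact_exists_lt A [set f | L f /\ forall x, A x -> - f x < g x + e / 2]
      (cst (-1) \* g \+ cst (e / 2)) cA.
- have [M M0 gM] := compact_bounded_fun cA cg.
  exists (cst M); split=> [|x Ax]; first exact: LS.
  have := gM x Ax; rewrite /= ler_norml => /andP[gM1 _].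
  by rewrite (le_lt_trans gM1)// ltrDl.
- by move=> [[]].
- split=> [|x Ax /=]; first exact: uniform_closure_min.
  by rewrite oppr_min gt_max fl// hl.
- apply: cvgD; last exact: cvg_cst.
  by apply: cvgMl_tmp; exact: cg.
- have [f [Lf fs] fg] := above s As.
  exists (cst (-1) \* f); last by rewrite /= !mulN1r fs ltrDl.
  by split=> [|x Ax /=]; [exact: uniform_closureZ|rewrite mulN1r opprK fg].
(* The function [- f] is within [e / 2] of [g]; the other half pays for replacing it by an element
   of [S]. *)
have [_ /(_ _ e20)[h Sh fh]] := uniform_closureZ (-1) Lf.
exists h => // x Ax; have := fh x Ax; have := fl x Ax; have := fg x Ax.
by rewrite /= !mulN1r !ltr_norml => ? ? /andP[? ?]; apply/andP; split; lra.
Qed.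
End Lattice.
End StoneWeierstrass.

(** * The reproducing kernel Hilbert space of a kernel *)

Local Open Scope complex_scope.

(** * Real and imaginary parts against the modulus *)

Section ComplexNorm.
Variable R : realType.
Local Notation normc := (@Normc.normc R).
Implicit Types z w : R[i].

Lemma normcE2 z : normc z ^+ 2 = complex.Re z ^+ 2 + complex.Im z ^+ 2.
Proof. by case: z => a b /=; rewrite sqr_sqrtr// addr_ge0// sqr_ge0. Qed.

Lemma normc_ge0 z : 0 <= normc z.
Proof. by case: z => a b; exact: sqrtr_ge0. Qed.

Lemma Re_norm_le z : `|complex.Re z| <= normc z.
Proof.
rewrite -ler_sqr ?nnegrE ?normc_ge0//.
by rewrite normcE2 real_normK ?num_real// lerDl sqr_ge0.
Qed.

Lemma Im_norm_le z : `|complex.Im z| <= normc z.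
Proof.
rewrite -ler_sqr ?nnegrE ?normc_ge0//.
by rewrite normcE2 real_normK ?num_real// lerDr sqr_ge0.
Qed.

Lemma Re_le_normc z : complex.Re z <= normc z.
Proof. exact: le_trans (ler_norm _) (Re_norm_le z). Qed.

Lemma normc_conj z : normc z^* = normc z.
Proof. by case: z => a b /=; rewrite sqrrN. Qed.

Lemma normc_real (a : R) : normc a%:C = `|a|.
Proof. by rewrite /= expr0n/= addr0 sqrtr_sqr. Qed.

Lemma normc_le_ReIm z : normc z <= `|complex.Re z| + `|complex.Im z|.
Proof.
rewrite -ler_sqr ?nnegrE ?normc_ge0 ?addr_ge0// normcE2 sqrrD.
rewrite !real_normK ?num_real//; rewrite addrAC lerDl.
by rewrite mulrn_wge0// mulr_ge0.
Qed.

Lemma ReD z w : complex.Re (z + w) = complex.Re z + complex.Re w.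
Proof. by case: z; case: w. Qed.

Lemma ImD z w : complex.Im (z + w) = complex.Im z + complex.Im w.
Proof. by case: z; case: w. Qed.

Lemma ReN z : complex.Re (- z) = - complex.Re z.
Proof. by case: z. Qed.

Lemma ImN z : complex.Im (- z) = - complex.Im z.
Proof. by case: z. Qed.

Lemma ReZ (a : R) z : complex.Re (a%:C * z) = a * complex.Re z.
Proof. by case: z => b c /=; rewrite mul0r subr0. Qed.

Lemma Re_conjc z : complex.Re z^* = complex.Re z.
Proof. by case: z. Qed.

Lemma mulcJ z : z^* * z = (normc z ^+ 2)%:C.
Proof.
rewrite normcE2; case: z => a b /=; apply/eqP; rewrite eq_complex/=.
by apply/andP; split; apply/eqP; ring.
Qed.

End ComplexNorm.

Lemma gt0_complex (R : realType) (z : R[i]) :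
  0 < z -> exists2 e : R, 0 < e & z = e%:C.
Proof. by case: z => a b; rewrite ltcE/= => /andP[/eqP -> a0]; exists a. Qed.

(** * The complete normed space of functions bounded on combinations of points *)

Section Combinations.
Variables (R : realType) (X : Type) (K : X -> X -> R[i]).
Local Notation C := R[i].
Local Notation normc := (@Normc.normc R).
Implicit Types (s t : seq (C * X)) (f g : X -> C).

(** A list of weighted points is a formal combination; points may repeat, so concatenation serves as
    addition. *)
Definition comb f s : C := \sum_(p <- s) p.1 * f p.2.

(** The coefficients are conjugated so that this function represents the functional [comb ^~ s] in
    an inner product conjugate-linear on the right. *)
Definition kernel_comb s : X -> C := fun x => \sum_(p <- s) p.1^* * K x p.2.

(** The squared kernel seminorm of a combination. The real part makes it a real number for arbitrary
    [K]. *)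
Definition kernel_quad s : R := complex.Re (comb (kernel_comb s) s).

Definition comb_scale (a : C) s := [seq (a * p.1, p.2) | p <- s].

Lemma comb_cat f s t : comb f (s ++ t) = comb f s + comb f t.
Proof. by rewrite /comb big_cat. Qed.

Lemma combZr f a s : comb f (comb_scale a s) = a * comb f s.
Proof.
by rewrite /comb big_map mulr_sumr; apply: eq_bigr => p _; rewrite mulrA.
Qed.

Lemma comb_ext f g s : f =1 g -> comb f s = comb g s.
Proof. by move=> fg; apply: eq_bigr => p _; rewrite fg. Qed.

Lemma combDl f g s : comb (fun x => f x + g x) s = comb f s + comb g s.
Proof. by rewrite /comb -big_split; apply: eq_bigr => p _; rewrite mulrDr. Qed.

Lemma combZl a f s : comb (fun x => a * f x) s = a * comb f s.
Proof. by rewrite /comb mulr_sumr; apply: eq_bigr => p _; rewrite mulrCA. Qed.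

Lemma comb1 f a x : comb f [:: (a, x)] = a * f x.
Proof. by rewrite /comb big_seq1. Qed.

Lemma kernel_comb_cat s t x :
  kernel_comb (s ++ t) x = kernel_comb s x + kernel_comb t x.
Proof. by rewrite /kernel_comb big_cat. Qed.

Lemma kernel_combZ a s x :
  kernel_comb (comb_scale a s) x = a^* * kernel_comb s x.
Proof.
rewrite /kernel_comb big_map mulr_sumr; apply: eq_bigr => p _.
by rewrite /= rmorphM mulrA.
Qed.

Definition bounded_comb f := exists M : R,
  0 <= M /\ forall s, normc (comb f s) <= M * Num.sqrt (kernel_quad s).

Definition rkhs_pred : {pred X -> C^o} := fun f => `[< bounded_comb f >].

Lemma rkhs_pred_submod : submod_closed rkhs_pred.
Proof.
split.
  apply/asboolP; exists 0; split=> // s.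
  rewrite /comb big1 ?mul0r ?Normc.normc0// => p _.
  by rewrite mulr0.
move=> a f g /asboolP[M [M0 fM]] /asboolP[N [N0 gN]]; apply/asboolP.
exists (normc a * M + N); split=> [|s].
  by rewrite addr_ge0// mulr_ge0// normc_ge0.
rewrite (@comb_ext _ (fun x => a * f x + g x))// combDl combZl.
apply: le_trans (le_normcD _ _) _; rewrite mulrDl Normc.normcM -mulrA.
by rewrite lerD// ler_wpM2l// normc_ge0.
Qed.

HB.instance Definition _ :=
  GRing.isSubmodClosed.Build C (X -> C^o) rkhs_pred rkhs_pred_submod.

Record rkhs := Rkhs { rkhs_fun : X -> C^o; _ : rkhs_fun \in rkhs_pred }.

HB.instance Definition _ := [isSub for rkhs_fun].
HB.instance Definition _ := [Choice of rkhs by <:].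
HB.instance Definition _ := [SubChoice_isSubLmodule of rkhs by <:].

Local Notation F := rkhs_fun.
Implicit Types u v w : rkhs.

Lemma rkhs_ext u v : F u =1 F v -> u = v.
Proof. by move=> uv; apply: val_inj; apply/funext. Qed.

Lemma rkhs_funD u v x : F (u + v) x = F u x + F v x.
Proof. by []. Qed.

Lemma rkhs_funZ a u x : F (a *: u) x = a * F u x.
Proof. by []. Qed.

Lemma rkhs_bounded u : bounded_comb (F u).
Proof. by case: u => f /= /asboolP. Qed.

Definition rkhs_bound u : set R :=
  [set M | 0 <= M /\ forall s, normc (comb (F u) s) <= M * Num.sqrt (kernel_quad s)].

(** The operator norm of [comb (F u)] with respect to the kernel seminorm. *)
Definition rkhs_norm u : R := inf (rkhs_bound u).
Local Notation N := rkhs_norm.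

Lemma rkhs_norm_le u (M : R) : 0 <= M ->
  (forall s, normc (comb (F u) s) <= M * Num.sqrt (kernel_quad s)) -> N u <= M.
Proof. by move=> M0 uM; apply: ge_inf => //; exists 0 => ? []. Qed.

Lemma rkhs_norm_ge0 u : 0 <= N u.
Proof.
apply: lb_le_inf; last by move=> ? [].
by have [M] := rkhs_bounded u; exists M.
Qed.

(** The infimum is itself a bound: divide by the seminorm of [s], or, where that is 0, use that any
    bound already forces the value 0. *)
Lemma comb_le u s : normc (comb (F u) s) <= N u * Num.sqrt (kernel_quad s).
Proof.
have [M0 [M00 uM0]] := rkhs_bounded u.
have := sqrtr_ge0 (kernel_quad s); rewrite le_eqVlt => /predU1P[q0|q0].
  by have := uM0 s; rewrite -q0 !mulr0.
rewrite -ler_pdivrMr//; apply: lb_le_inf; first by exists M0.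
by move=> M [_ uM]; rewrite ler_pdivrMr.
Qed.

Lemma combDF u v s : comb (F (u + v)) s = comb (F u) s + comb (F v) s.
Proof. exact: combDl. Qed.

Lemma combZF a u s : comb (F (a *: u)) s = a * comb (F u) s.
Proof. exact: combZl. Qed.

Lemma combBF u v s : comb (F (u - v)) s = comb (F u) s - comb (F v) s.
Proof. by rewrite -scaleN1r combDF combZF mulN1r. Qed.

Lemma rkhs_normD u v : N (u + v) <= N u + N v.
Proof.
apply: rkhs_norm_le => [|s]; first by rewrite addr_ge0 ?rkhs_norm_ge0.
rewrite combDF (le_trans (le_normcD _ _))// mulrDl.
by rewrite lerD ?comb_le.
Qed.

(** One inequality gives both: the reverse one is the same statement for [a^-1] and [a *: u]. *)
Lemma rkhs_normZ a u : N (a *: u) = normc a * N u.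
Proof.
have le b w : N (b *: w) <= normc b * N w.
  apply: rkhs_norm_le => [|s]; first by rewrite mulr_ge0 ?rkhs_norm_ge0 ?normc_ge0.
  by rewrite combZF Normc.normcM -mulrA ler_wpM2l ?normc_ge0 ?comb_le.
have [->|a0] := eqVneq a 0.
  by apply: le_anti; rewrite le Normc.normc0 mul0r rkhs_norm_ge0.
apply: le_anti; rewrite le andTb.
have := le a^-1 (a *: u); rewrite scalerA mulVf// scale1r => h.
have a0' : 0 < normc a.
  by rewrite lt_def normc_ge0 andbT; apply: contra_neq a0; exact: Normc.eq0_normc.
by rewrite mulrC -ler_pdivlMr// mulrC -Normc.normcV.
Qed.

(** Evaluation at [x] is the one-term combination [[:: (1, x)]], hence controlled by the norm. *)
Lemma rkhs_norm0_eq0 u : N u = 0 -> u = 0.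
Proof.
move=> u0; apply: rkhs_ext => x; apply: Normc.eq0_normc.
apply: le_anti; rewrite normc_ge0 andbT.
by have := comb_le u [:: (1, x)]; rewrite u0 mul0r comb1 mul1r.
Qed.

Let rkhs_cnormD u v : (N (u + v))%:C <= (N u)%:C + (N v)%:C.
Proof. by rewrite -rmorphD lecR rkhs_normD. Qed.

Let rkhs_cnormZ (a : C) u : (N (a *: u))%:C = `|a| * (N u)%:C.
Proof. by rewrite rkhs_normZ rmorphM. Qed.

Let rkhs_cnorm0_eq0 u : (N u)%:C = 0 -> u = 0.
Proof. by move=> [/rkhs_norm0_eq0]. Qed.

HB.instance Definition _ := @Lmodule_isNormed.Build C rkhs
  (fun u => (N u)%:C) rkhs_cnormD rkhs_cnormZ rkhs_cnorm0_eq0.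

Lemma rkhs_normE u : `|u| = (N u)%:C.
Proof. by []. Qed.

(** Here [f] is a bare function: the lemma carries bounds over to a pointwise limit before it is
    known to lie in the space. *)
Lemma comb_near (G : set_system rkhs) (f : X -> C) : ProperFilter G ->
  (forall x e, 0 < e -> \forall v \near G, normc (f x - F v x) < e) ->
  forall s e, 0 < e -> \forall v \near G, normc (comb f s - comb (F v) s) < e.
Proof.
move=> PG fG; elim=> [|[a x] s IH] e e0.
  by apply: nearW => v; rewrite /comb !big_nil subrr Normc.normc0.
have e20 : 0 < e / 2 by rewrite divr_gt0.
have a0 : 0 < normc a + 1 by rewrite ltr_wpDl ?normc_ge0.
near=> v.
rewrite /comb !big_cons/= -/(comb _ _) -/(comb _ _) opprD addrACA -mulrBr.
rewrite (le_lt_trans (le_normcD _ _))// [e]splitr ltrD//; last by near: v; exact: IH.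
rewrite Normc.normcM (@le_lt_trans _ _ ((normc a + 1) * normc (f x - F v x)))//.
  by rewrite ler_wpM2r ?normc_ge0// lerDl.
by rewrite mulrC -ltr_pdivlMr//; near: v; apply: fG; rewrite divr_gt0.
Unshelve. all: by end_near. Qed.

Lemma rkhs_cauchyP (G : set_system rkhs) : ProperFilter G -> cauchy G ->
  forall e : R, 0 < e -> exists u, G [set v | N (u - v) < e].
Proof.
move=> PG /cauchyP Gc e e0; have [|u uG] := Gc e%:C; first by rewrite ltcR.
exists u; apply: filterS uG => v; rewrite -ball_normE /ball_/= rkhs_normE.
by rewrite ltcR.
Qed.

(** Applied to the real and imaginary parts of evaluations, this reduces pointwise convergence to
    the completeness of [R]. *)
Lemma rkhs_lipschitz_cvg (G : set_system rkhs) (phi : rkhs -> R) (c : R) :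
  ProperFilter G -> cauchy G -> 0 <= c ->
  (forall u v, `|phi u - phi v| <= N (u - v) * c) -> cvg (phi @ G).
Proof.
move=> PG Gc c0 phiL; apply: cauchy_cvg; apply/cauchy_exP => e e0.
have c10 : 0 < c + 1 by rewrite ltr_wpDl.
have [u uG] := rkhs_cauchyP PG Gc (divr_gt0 e0 c10).
exists (phi u); apply: (@filterS _ G _ _ _ _ uG) => v uv.
have {}uv : N (u - v) * (c + 1) < e by rewrite -ltr_pdivlMr.
rewrite -ball_normE /ball_/= (le_lt_trans (phiL _ _))//.
by rewrite (le_lt_trans _ uv)// ler_wpM2l ?rkhs_norm_ge0// lerDl.
Qed.

Lemma rkhs_pointwise_lim (G : set_system rkhs) : ProperFilter G -> cauchy G ->
  exists f : X -> C, forall x e, 0 < e -> \forall v \near G, normc (f x - F v x) < e.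
Proof.
move=> PG Gc.
have dist x u v : normc (F u x - F v x) <=
    N (u - v) * Num.sqrt (kernel_quad [:: (1, x)]).
  by have := comb_le (u - v) [:: (1, x)]; rewrite comb1 mul1r.
have cvgRe x : cvg ((fun u => complex.Re (F u x)) @ G).
  apply: (rkhs_lipschitz_cvg PG Gc (sqrtr_ge0 (kernel_quad [:: (1, x)]))) => u v.
  apply: le_trans (dist _ _ _); rewrite -ReN -ReD.
  exact: Re_norm_le.
have cvgIm x : cvg ((fun u => complex.Im (F u x)) @ G).
  apply: (rkhs_lipschitz_cvg PG Gc (sqrtr_ge0 (kernel_quad [:: (1, x)]))) => u v.
  apply: le_trans (dist _ _ _); rewrite -ImN -ImD.
  exact: Im_norm_le.
exists (fun x => lim ((fun u => complex.Re (F u x)) @ G)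
  +i* lim ((fun u => complex.Im (F u x)) @ G)) => x e e0.
have e20 : 0 < e / 2 by rewrite divr_gt0.
near=> v; rewrite (le_lt_trans (normc_le_ReIm _))// [e]splitr.
rewrite ReD ReN ImD ImN/= ltrD//; near: v.
  exact: cvgr_dist_lt e20.
exact: cvgr_dist_lt e20.
Unshelve. all: by end_near. Qed.

Lemma rkhs_complete (G : set_system rkhs) : ProperFilter G -> cauchy G -> cvg G.
Proof.
move=> PG Gc; have [f fG] := rkhs_pointwise_lim PG Gc.
(* Bounds on a tail of the filter pass to the pointwise limit [f]. At radius 1 they show that [f] is
   in the space, at radius [e / 2] that the filter converges to it in norm. *)
have close u e : 0 < e -> G [set v | N (u - v) < e] -> forall s,
    normc (comb (F u) s - comb f s) <= e * Num.sqrt (kernel_quad s).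
  move=> e0 uG s; apply/ler_addgt0Pr => d d0.
  near G => v.
  have -> : comb (F u) s - comb f s =
    comb (F (u - v)) s + - (comb f s - comb (F v) s).
    by rewrite combBF; ring.
  rewrite (le_trans (le_normcD _ _))// lerD//.
    rewrite (le_trans (comb_le _ _))// ler_wpM2r ?sqrtr_ge0//.
    by apply/ltW; near: v.
  by rewrite normcN ltW//; near: v; exact: comb_near.
have fb : f \in rkhs_pred.
  have [u uG] := rkhs_cauchyP PG Gc ltr01.
  apply/asboolP; exists (N u + 1); split=> [|s].
    by rewrite addr_ge0 ?rkhs_norm_ge0.
  have -> : comb f s = comb (F u) s + - (comb (F u) s - comb f s) by ring.
  rewrite (le_trans (le_normcD _ _))// mulrDl lerD ?comb_le//.
  by rewrite normcN close.
apply/cvg_ex; exists (Rkhs fb); apply/fcvgrPdist_lt => _ /gt0_complex[e e0 ->].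
have e20 : 0 < e / 2 by rewrite divr_gt0.
have [u uG] := rkhs_cauchyP PG Gc e20.
apply: filterS (uG) => v /= uv; rewrite rkhs_normE ltcR.
have -> : Rkhs fb - v = -1 *: (u - Rkhs fb) + (u - v).
  by rewrite scaleN1r opprB addrA subrK.
rewrite (le_lt_trans (rkhs_normD _ _))// rkhs_normZ normcN Normc.normc1 mul1r.
rewrite [e]splitr ler_ltD//; apply: rkhs_norm_le; first exact: ltW.
move=> s; rewrite combBF; exact: close.
Unshelve. all: by end_near. Qed.

HB.instance Definition _ := Uniform_isComplete.Build rkhs rkhs_complete.

End Combinations.

(** * The inner product, recovered from the norm *)

Section RkhsDot.
Variables (R : realType) (X : Type) (K : X -> X -> R[i]).
Local Notation C := R[i].
Local Notation normc := (@Normc.normc R).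
Local Notation Q := (kernel_quad K).
Local Notation F := (@rkhs_fun R X K).
Local Notation N := (@rkhs_norm R X K).
Implicit Types (s t : seq (C * X)) (u v w : rkhs K).

Hypothesis Kherm : forall x y, K y x = (K x y)^*.
Hypothesis Kpos : forall s, 0 <= Q s.

Lemma comb_kernel_sym s t :
  comb (kernel_comb K t) s = (comb (kernel_comb K s) t)^*.
Proof.
rewrite /comb /kernel_comb rmorph_sum/=.
under eq_bigr do rewrite mulr_sumr.
under [RHS]eq_bigr do rewrite mulr_sumr rmorph_sum.
rewrite exchange_big/=; apply: eq_bigr => p _; apply: eq_bigr => q _.
by rewrite !rmorphM/= !conjcK -Kherm mulrCA.
Qed.

Lemma kernel_quad_cat s t :
  Q (s ++ t) = Q s + Q t + 2 * complex.Re (comb (kernel_comb K t) s).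
Proof.
rewrite /kernel_quad comb_cat !(comb_ext _ (kernel_comb_cat K s t)).
rewrite !combDl !ReD [in X in _ + _ + (X + _)]comb_kernel_sym Re_conjc.
ring.
Qed.

Lemma kernel_quadZ a s : Q (comb_scale a s) = normc a ^+ 2 * Q s.
Proof.
rewrite /kernel_quad combZr (comb_ext _ (kernel_combZ K a s)) combZl mulrA.
by rewrite [a * _]mulrC mulcJ ReZ.
Qed.

Lemma kernel_quadN s : Q (comb_scale (-1) s) = Q s.
Proof. by rewrite kernel_quadZ normcN Normc.normc1 expr1n mul1r. Qed.

(* Scaling [s] by [t * (comb f s)^*] makes the hypothesis a quadratic inequality in
   the real number [t]. *)
Lemma quad_bound (f : X -> C) (m : R) :
  (forall s, 2 * complex.Re (comb f s) - Q s <= m) ->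
  forall s, normc (comb f s) ^+ 2 <= m * Q s.
Proof.
move=> fm s; set z := comb f s; pose a := normc z ^+ 2.
have at_ (t : R) : 2 * (t * a) - t ^+ 2 * a * Q s <= m.
  have := fm (comb_scale (t%:C * z^*) s).
  rewrite combZr kernel_quadZ -/z -mulrA mulcJ ReZ/= Normc.normcM normc_conj.
  by rewrite normc_real exprMn real_normK ?num_real.
have a0 : 0 <= a by exact: sqr_ge0.
have [Q0|QN0] := eqVneq (Q s) 0; last first.
  have Qp : 0 < Q s by rewrite lt_def QN0 Kpos.
  (* The quadratic polynomial in [t] is maximal at [(Q s)^-1]. *)
  rewrite -/a -ler_pdivrMr//; apply: le_trans (at_ (Q s)^-1).
  by rewrite le_eqVlt; apply/orP; left; apply/eqP; field.
rewrite -/a Q0 mulr0 leNgt; apply/negP => ap.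
(* Without its quadratic term the inequality is linear in [t], and this value would give
   [m + 1 <= m]. *)
have := at_ ((m + 1) / (2 * a)); rewrite Q0 mulr0 subr0.
have -> : 2 * ((m + 1) / (2 * a) * a) = m + 1 by field; rewrite gt_eqF.
by rewrite gerDl ler10.
Qed.

Lemma quad_bound_sqrt (f : X -> C) (m : R) :
  (forall s, 2 * complex.Re (comb f s) - Q s <= m) ->
  forall s, normc (comb f s) <= Num.sqrt m * Num.sqrt (Q s).
Proof.
move=> fm s.
have m0 : 0 <= m.
  by have := fm [::]; rewrite /kernel_quad /comb !big_nil/= mulr0 subr0.
rewrite -sqrtrM// -[leLHS]ger0_norm ?normc_ge0// -sqrtr_sqr.
by rewrite ler_wsqrtr// quad_bound.
Qed.

(** With [quad_le_rkhs_norm] this makes [N u ^+ 2] the supremum over [s] of 2 Re (comb u s) - Q s, a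
    form in which identities between squared norms come from substitutions in [s]. *)
Lemma rkhs_norm_quad_le u (m : R) :
  (forall s, 2 * complex.Re (comb (F u) s) - Q s <= m) -> N u ^+ 2 <= m.
Proof.
move=> um.
have m0 : 0 <= m.
  by have := um [::]; rewrite /kernel_quad /comb !big_nil/= mulr0 subr0.
rewrite -(sqr_sqrtr m0) ler_sqr ?nnegrE ?sqrtr_ge0 ?rkhs_norm_ge0//.
by apply: rkhs_norm_le; [exact: sqrtr_ge0|exact: quad_bound_sqrt].
Qed.

Lemma quad_le_rkhs_norm u s : 2 * complex.Re (comb (F u) s) - Q s <= N u ^+ 2.
Proof.
have := le_trans (Re_le_normc _) (comb_le u s).
rewrite -{2}(sqr_sqrtr (Kpos s)).
have := sqr_ge0 (N u - Num.sqrt (Q s)).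
by move: (Num.sqrt _) (N u) (complex.Re _) => q n r; nra.
Qed.

(** The Cauchy-Schwarz inequality for the kernel seminorm, from the positivity of [Q] at s - t. *)
Lemma kernel_comb_bounded t : (kernel_comb K t : X -> C^o) \in rkhs_pred K.
Proof.
apply/asboolP; exists (Num.sqrt (Q t)); split; first exact: sqrtr_ge0.
apply: quad_bound_sqrt => s.
have := Kpos (s ++ comb_scale (-1) t); rewrite kernel_quad_cat kernel_quadN.
rewrite (comb_ext _ (kernel_combZ K _ _)) combZl.
rewrite rmorphN1 mulN1r ReN; lra.
Qed.

Definition rkhs_comb t : rkhs K := Rkhs (kernel_comb_bounded t).

Lemma rkhs_combZ a s : rkhs_comb (comb_scale a s) = a^* *: rkhs_comb s.
Proof. by apply: rkhs_ext => x; rewrite rkhs_funZ/= kernel_combZ. Qed.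

Lemma rkhs_combN s : rkhs_comb (comb_scale (-1) s) = - rkhs_comb s.
Proof. by rewrite rkhs_combZ rmorphN1 scaleN1r. Qed.

(** A competitor t in the supremum for the left side is compared with the competitor t - s in the
    supremum for [u]. *)
Lemma rkhs_normDcomb_le u s :
  N (u + rkhs_comb s) ^+ 2 <= N u ^+ 2 + 2 * complex.Re (comb (F u) s) + Q s.
Proof.
apply: rkhs_norm_quad_le => t.
have := quad_le_rkhs_norm u (t ++ comb_scale (-1) s).
rewrite comb_cat combZr kernel_quad_cat kernel_quadN.
rewrite (comb_ext _ (kernel_combZ K _ _)) combZl combDF.
rewrite rmorphN1 !mulN1r !(ReD, ReN)/=; lra.
Qed.

(** The reverse inequality is the previous lemma at [u + rkhs_comb s] and -s. *)
Lemma rkhs_normDcomb u s :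
  N (u + rkhs_comb s) ^+ 2 = N u ^+ 2 + 2 * complex.Re (comb (F u) s) + Q s.
Proof.
apply: le_anti; rewrite rkhs_normDcomb_le andTb.
have := rkhs_normDcomb_le (u + rkhs_comb s) (comb_scale (-1) s).
rewrite rkhs_combN addrK kernel_quadN combZr combDF mulN1r ReN ReD.
rewrite -/(Q s); lra.
Qed.

Lemma rkhs_norm_comb s : N (rkhs_comb s) ^+ 2 = Q s.
Proof.
apply: le_anti; apply/andP; split.
  have := rkhs_normDcomb_le 0 s; rewrite add0r.
  have -> : N 0 = 0 by have := rkhs_normZ (0 : C) (0 : rkhs K); rewrite scale0r Normc.normc0 mul0r.
  have -> : comb (F 0) s = 0 by rewrite /comb big1// => p _; rewrite mulr0.
  by rewrite expr0n/= mulr0 !add0r.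
by have := quad_le_rkhs_norm (rkhs_comb s) s; rewrite /= -/(Q s); lra.
Qed.

(* A near-maximizer [s] of [2 Re (comb u s) - Q s] is near [u], since the norm of
   [u - rkhs_comb s] squared is the defect of [s]. *)
Lemma rkhs_comb_dense u (e : R) : 0 < e -> exists s, N (u - rkhs_comb s) < e.
Proof.
move=> e0.
have [s us] : exists s, N u ^+ 2 - e ^+ 2 < 2 * complex.Re (comb (F u) s) - Q s.
  apply: contrapT => /forallNP nus.
  have /rkhs_norm_quad_le : forall s,
      2 * complex.Re (comb (F u) s) - Q s <= N u ^+ 2 - e ^+ 2.
    by move=> s; rewrite leNgt; apply/negP; exact: nus.
  by move=> h; have := exprn_gt0 2 e0; lra.
exists s; rewrite -ltr_sqr ?nnegrE ?rkhs_norm_ge0 ?(ltW e0)//.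
rewrite -rkhs_combN rkhs_normDcomb kernel_quadN combZr mulN1r ReN; lra.
Qed.

(** Polarization of the norm. Additivity is not visible here; it comes by density from
    [rkhs_rdot_comb], whose right side is additive in [u]. *)
Definition rkhs_rdot u v : R := (N (u + v) ^+ 2 - N u ^+ 2 - N v ^+ 2) / 2.

Lemma rkhs_rdotC u v : rkhs_rdot u v = rkhs_rdot v u.
Proof. by rewrite /rkhs_rdot [v + u]addrC addrAC. Qed.

Lemma rkhs_rdot_comb u s : rkhs_rdot u (rkhs_comb s) = complex.Re (comb (F u) s).
Proof. by rewrite /rkhs_rdot rkhs_normDcomb rkhs_norm_comb; field. Qed.

Lemma rkhs_rdot_ii u v : rkhs_rdot ('i *: u) ('i *: v) = rkhs_rdot u v.
Proof.
have normi : normc 'i = 1 by rewrite /= expr0n expr1n add0r sqrtr1.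
by rewrite /rkhs_rdot -scalerDr !rkhs_normZ normi !mul1r.
Qed.

(** One sequence serves every [u], so relations linear in [u] pass from combinations to the limit
    [v]. *)
Lemma rkhs_rdot_cvg v : exists s : nat -> seq (C * X),
  forall u, (fun n => complex.Re (comb (F u) (s n))) @ \oo --> rkhs_rdot u v.
Proof.
have /choice[s sP] n : exists s, N (v - rkhs_comb s) < n.+1%:R^-1.
  by apply: rkhs_comb_dense; rewrite invr_gt0.
have Ncvg u : (fun n => N (u + rkhs_comb (s n))) @ \oo --> N (u + v).
  apply/cvgrPdist_lt => e e0; near=> n.
  apply: (@le_lt_trans _ _ (N (v - rkhs_comb (s n)))); last first.
    by rewrite (lt_trans (sP n))//; near: n; exact: (near_infty_natSinv_lt (PosNum e0)).
  have NB w1 w2 : N w1 <= N w2 + N (w1 - w2).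
    by have := rkhs_normD w2 (w1 - w2); rewrite addrC subrK.
  have NBC w1 w2 : N (w1 - w2) = N (w2 - w1).
    by rewrite -opprB -scaleN1r rkhs_normZ normcN Normc.normc1 mul1r.
  have BE : u + v - (u + rkhs_comb (s n)) = v - rkhs_comb (s n).
    by rewrite opprD addrACA subrr add0r.
  rewrite ler_norml -BE; apply/andP; split.
    by have := NB (u + rkhs_comb (s n)) (u + v); rewrite NBC; lra.
  by have := NB (u + v) (u + rkhs_comb (s n)); lra.
exists s => u; under eq_fun do rewrite -rkhs_rdot_comb.
apply: cvgM; last exact: cvg_cst.
apply: cvgB; first apply: cvgB.
- by under eq_fun do rewrite expr2; rewrite expr2; apply: cvgM.
- exact: cvg_cst.
(* The norm of [rkhs_comb (s n)] is read as that of its sum with 0. *)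
- have N0 := Ncvg 0; rewrite add0r in N0.
  under eq_fun do rewrite -[X in N X]add0r expr2.
  by rewrite expr2; apply: cvgM.
Unshelve. all: by end_near. Qed.

Lemma rkhs_rdotDl u1 u2 v :
  rkhs_rdot (u1 + u2) v = rkhs_rdot u1 v + rkhs_rdot u2 v.
Proof.
have [s sP] := rkhs_rdot_cvg v.
apply: (cvg_unique _ (sP (u1 + u2))) => //=.
under eq_fun do rewrite combDF ReD.
by apply: cvgD; exact: sP.
Qed.

Lemma rkhs_rdotZl (a : R) u v : rkhs_rdot (a%:C *: u) v = a * rkhs_rdot u v.
Proof.
have [s sP] := rkhs_rdot_cvg v.
apply: (cvg_unique _ (sP (a%:C *: u))) => //=.
under eq_fun do rewrite combZF ReZ.
by apply: cvgMl_tmp; exact: sP.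
Qed.

Lemma rkhs_rdotNl u v : rkhs_rdot (- u) v = - rkhs_rdot u v.
Proof.
by have := rkhs_rdotZl (-1) u v; rewrite rmorphN1 scaleN1r mulN1r.
Qed.

Lemma rkhs_rdotil u v : rkhs_rdot ('i *: u) v = - rkhs_rdot u ('i *: v).
Proof.
rewrite -(rkhs_rdot_ii ('i *: u)) scalerA.
have -> : 'i * 'i = -1 :> C by rewrite -expr2 sqr_i.
by rewrite scaleN1r rkhs_rdotNl.
Qed.

Lemma rkhs_rdotuu u : rkhs_rdot u u = N u ^+ 2.
Proof.
rewrite /rkhs_rdot -mulr2n -scaler_nat rkhs_normZ.
have -> : normc (2%:R : C) = 2 by rewrite normcMn Normc.normc1.
by field.
Qed.

Lemma rkhs_rdotui u : rkhs_rdot u ('i *: u) = 0.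
Proof. by have := rkhs_rdotil u u; rewrite rkhs_rdotC => h; lra. Qed.

(** Conjugate-linearity on the right turns Im <u, v> into Re <u, iv>. *)
Definition rkhs_cdot u v : C := rkhs_rdot u v +i* rkhs_rdot u ('i *: v).

Lemma rkhs_cdot_comb u s : rkhs_cdot u (rkhs_comb s) = comb (F u) s.
Proof.
rewrite /rkhs_cdot.
have -> : 'i *: rkhs_comb s = rkhs_comb (comb_scale (- 'i) s).
  by rewrite rkhs_combZ; congr (_ *: _); apply/eqP; rewrite eq_complex/= !oppr0 opprK !eqxx.
rewrite !rkhs_rdot_comb combZr.
case: (comb _ _) => a b; apply/eqP; rewrite eq_complex/= eqxx/=; apply/eqP.
ring.
Qed.

Lemma rkhs_cdot_linear v : scalar (rkhs_cdot ^~ v).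
Proof.
move=> a u1 u2; case: a => a b.
have -> : (a +i* b) *: u1 = a%:C *: u1 + b%:C *: ('i *: u1).
  rewrite scalerA -scalerDl; congr (_ *: _).
  by apply/eqP; rewrite eq_complex/=; apply/andP; split; apply/eqP; ring.
have -> (y z : C) : (a +i* b) * y + z = a%:C * y + b%:C * ('i * y) + z.
  rewrite mulrA -mulrDl; congr (_ * _ + _).
  by apply/eqP; rewrite eq_complex/=; apply/andP; split; apply/eqP; ring.
rewrite /rkhs_cdot !rkhs_rdotDl !rkhs_rdotZl !rkhs_rdotil scalerA.
have -> : 'i * 'i = -1 :> C by rewrite -expr2 sqr_i.
rewrite scaleN1r [rkhs_rdot u1 (- v)]rkhs_rdotC rkhs_rdotNl (rkhs_rdotC v).
by apply/eqP; rewrite eq_complex/=; apply/andP; split; apply/eqP; ring.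
Qed.

Lemma rkhs_cdot_conj u v : rkhs_cdot u v = (rkhs_cdot v u)^*.
Proof.
rewrite /rkhs_cdot; apply/eqP; rewrite eq_complex/= rkhs_rdotC eqxx/=.
by rewrite -rkhs_rdotil rkhs_rdotC.
Qed.

Lemma rkhs_cdot_bilinear :
  bilinear_for (GRing.mul : C -> C -> C) (@conjc R \; *%R) rkhs_cdot.
Proof.
split=> [v a u w|u a v w]; first exact: rkhs_cdot_linear.
rewrite rkhs_cdot_conj rkhs_cdot_linear rmorphD rmorphM.
by rewrite (rkhs_cdot_conj u v) (rkhs_cdot_conj u w).
Qed.

Lemma rkhs_cdotuu u : rkhs_cdot u u = `|u| ^+ 2.
Proof. by rewrite /rkhs_cdot rkhs_rdotui rkhs_rdotuu rkhs_normE -rmorphXn. Qed.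

Let rkhs_cdot_herm u v : rkhs_cdot u v = (-1) ^+ false * (rkhs_cdot v u)^*.
Proof. by rewrite expr0 mul1r rkhs_cdot_conj. Qed.

Let rkhs_cdot_gt0 u : u != 0 -> 0 < rkhs_cdot u u.
Proof. by move=> u0; rewrite rkhs_cdotuu exprn_gt0// normr_gt0. Qed.

Definition rkhs_dot : {dot rkhs K for @conjc R} :=
  HB.pack_for {dot rkhs K for @conjc R} rkhs_cdot
    (@bilinear_isBilinear.Build C (rkhs K) (rkhs K) C _ _ rkhs_cdot rkhs_cdot_bilinear)
    (@isHermitianSesquilinear.Build C (rkhs K) false (@conjc R) rkhs_cdot rkhs_cdot_herm)
    (@isDotProduct.Build C (rkhs K) rkhs_cdot rkhs_cdot_gt0).

End RkhsDot.

(** * The reproducing property and the forms attached to the kernel *)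

Section RkhsExists.
Variables (R : realType) (X : Type) (K : X -> X -> R[i]).
Local Notation C := R[i].
Hypothesis Kherm : forall x y, K y x = (K x y)^*.
Hypothesis Kpos : forall s, 0 <= kernel_quad K s.

Let k (y : X) : rkhs K := rkhs_comb Kherm Kpos [:: (1, y)].

Let kE y x : rkhs_fun (k y) x = K x y.
Proof. by rewrite [LHS]big_seq1 -[RHS]mul1r; congr (_ * _); exact: conjc1. Qed.

Lemma rkhs_comb_sum s :
  rkhs_comb Kherm Kpos s = \sum_(p <- s) p.1^* *: k p.2.
Proof.
elim: s => [|[a y] s IH].
  by rewrite big_nil; apply: rkhs_ext => x; rewrite /= /kernel_comb big_nil.
rewrite big_cons -IH; apply: rkhs_ext => x.
by rewrite rkhs_funD rkhs_funZ kE /= /kernel_comb big_cons.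
Qed.

Lemma rkhs_is_rkhs :
  is_rkhs K (rkhs_dot Kherm Kpos) (fun u : rkhs K => (rkhs_fun u : X -> C)).
Proof.
split.
- by move=> u; exact: rkhs_cdotuu.
- by split=> // u v uv; apply: rkhs_ext => x; rewrite uv.
- exists k; split=> [y|u y|].
  + by apply/funext => x; exact: kE.
  + by rewrite [LHS]rkhs_cdot_comb comb1 mul1r.
  move=> O [u Ou] oO.
  have /nbhs_ballP[_ /gt0_complex[e e0 ->] uO] : nbhs u O by exact: open_nbhs_nbhs.
  have [s us] := rkhs_comb_dense Kherm Kpos u e0.
  exists (rkhs_comb Kherm Kpos s); split.
    by apply: uO; rewrite -ball_normE /ball_/= rkhs_normE ltcR.
  exists (size s), (fun i => (tnth (in_tuple s) i).1^*),
    (fun i => k (tnth (in_tuple s) i).2).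
  by split=> [i|]; [exists (tnth (in_tuple s) i).2|rewrite rkhs_comb_sum big_tnth].
Qed.

Lemma kernel_form_comb n (x : 'I_n -> X) (c : 'I_n -> C) :
  kernel_form K x c = comb (kernel_comb K [seq (c i, x i) | i <- enum 'I_n])
    [seq (c i, x i) | i <- enum 'I_n].
Proof.
rewrite /kernel_form /comb big_map big_enum/=; apply: eq_bigr => i _.
rewrite /kernel_comb big_map big_enum/= mulr_sumr.
by apply: eq_bigr => j _; rewrite mulrA.
Qed.

(** [Kpos] speaks of the real part only; Hermitian symmetry makes the form equal to its own
    conjugate, so the imaginary part is 0. *)
Lemma kernel_quad_positive_definite : positive_definite K.
Proof.
move=> n x c _; rewrite kernel_form_comb; set s := [seq _ | _ <- _].
have := Kpos s; rewrite /kernel_quad lecE/= => ->; rewrite andbT.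
have /(congr1 (@complex.Im R)) := comb_kernel_sym Kherm s s.
by case: (comb _ _) => a b /= bN; apply/eqP; lra.
Qed.

(** By [comb_le] a combination of seminorm 0 is annihilated by every function of the space, in
    particular by [k y]. *)
Lemma kernel_form_eq0 n (x : 'I_n -> X) (c : 'I_n -> C) :
  kernel_form K x c = 0 -> forall y, \sum_i c i * K (x i) y = 0.
Proof.
rewrite kernel_form_comb; set s := [seq _ | _ <- _] => s0 y.
have := comb_le (k y) s; rewrite /kernel_quad s0 /= sqrtr0 mulr0 => ky0.
have : comb (kernel_comb K [:: (1, y)]) s = 0.
  by apply: Normc.eq0_normc; apply: le_anti; rewrite ky0 normc_ge0.
rewrite /comb big_map big_enum/= => s1; rewrite -[RHS]s1; apply: eq_bigr => i _.
by rewrite [kernel_comb _ _ _]kE.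
Qed.

End RkhsExists.

(** Multiply, over the points [y] of [l], functions equal to 1 at [x] and 0 at [y]. *)
Lemma function_algebra_annihilator (R : realType) (T : ptopologicalType)
    (S : set (T -> R)) (x : T) (l : seq T) :
  function_algebra S ->
  (forall y z, y <> z -> exists2 f, S f & f y <> f z) -> x \notin l ->
  exists2 f, S f & f x = 1 /\ forall y, y \in l -> f y = 0.
Proof.
move=> Salg sep; have [Sc SD SM] := Salg.
elim: l => [|y l IH]; first by exists (cst 1).
rewrite inE negb_or => /andP[/eqP xy /IH[f Sf [fx fl]]].
have [|h Sh [hx hy]] := @separating_interpolation R T setT S Salg x y 1 0
    (fun y z _ _ => sep y z) I I; first by [].
exists (f \* h); first exact: SM.
split=> [|z]; rewrite /= ?fx ?hx ?mulr1// inE => /predU1P[->|zl].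
  by rewrite hy mulr0.
by rewrite fl// mul0r.
Qed.

(** * The Gaussian kernel *)

Section Gaussian.
Variables (R : realType) (H : completeNormedModType R) (dot : {dot H for idfun}).
Hypothesis hdot : induces_norm dot.
Variable sigma : R.
Hypothesis hsigma : 0 < sigma.
Local Notation C := R[i].
Local Notation normc := (@Normc.normc R).
Local Notation G := (fun x y : H => (gaussian sigma x y)%:C : C).

Definition gauss_weight (x : H) : R := expR (- sigma * `|x| ^+ 2).
Local Notation w := gauss_weight.

Lemma gaussian_weight (x y : H) :
  gaussian sigma x y = w x * w y * expR (2 * sigma * dot x y).
Proof.
rewrite /gaussian /w -!expRD -!hdot !(dotBl, dotBr) (dot_sym dot y x).
by congr expR; ring.
Qed.

Lemma gaussian_sym (x y : H) : gaussian sigma x y = gaussian sigma y x.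
Proof. by rewrite /gaussian distrC. Qed.

Lemma gaussian_herm (x y : H) : G y x = (G x y)^*.
Proof. by rewrite conjc_real gaussian_sym. Qed.

(** The weights go into the coefficients, and the factor [2 * sigma] into the vectors, scaled by its
    square root [r]. *)
Lemma psd_gaussian n (x : 'I_n -> H) :
  psd (fun i j => gaussian sigma (x i) (x j)).
Proof.
move=> a; pose r := Num.sqrt (2 * sigma).
have rr : r * r = 2 * sigma.
  by rewrite -expr2 sqr_sqrtr// mulr_ge0// ltW.
have := psd_expR_gram dot (fun i => r *: x i) (fun i => a i * w (x i)).
congr (_ <= _); apply: eq_bigr => i _; apply: eq_bigr => j _.
by rewrite gaussian_weight dotZl dotZr [r * (r * _)]mulrA rr; ring.
Qed.

(** As the kernel is real, the real part splits into one real form in the real parts of the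
    coefficients and one in their imaginary parts. *)
Lemma kernel_quad_gaussian_ge0 s : 0 <= kernel_quad G s.
Proof.
have ReM (z z' : C) (a : R) : complex.Re (z * (z'^* * a%:C)) =
    complex.Re z * complex.Re z' * a + complex.Im z * complex.Im z' * a.
  by case: z; case: z' => ? ? ? ? /=; ring.
have ReS I (r : seq I) (f : I -> C) :
    complex.Re (\sum_(i <- r) f i) = \sum_(i <- r) complex.Re (f i).
  by elim/big_rec2: _ => // i y1 y2 _ <-; rewrite ReD.
rewrite /kernel_quad /comb /kernel_comb big_tnth ReS.
under eq_bigr => i _.
  rewrite [X in _ * X]big_tnth mulr_sumr ReS.
  under eq_bigr do rewrite ReM.
  rewrite big_split; over.
by rewrite big_split/= addr_ge0// (psd_gaussian (fun i => (tnth (in_tuple s) i).2)).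
Qed.

(** * The algebra spanned by exponentials of linear functionals *)

Definition exp_span : set (H -> R) :=
  [set f | exists s : seq (R * H),
     f = fun x => \sum_(p <- s) p.1 * expR (dot x p.2)].

Lemma exp_span_algebra : function_algebra exp_span.
Proof.
split=> [c|_ _ [s ->] [t ->]|_ _ [s ->] [t ->]].
- exists [:: (c, 0)]; apply/funext => x.
  by rewrite big_seq1/= linear0r expR0 mulr1.
- by exists (s ++ t); apply/funext => x; rewrite big_cat.
- exists [seq (p.1 * q.1, p.2 + q.2) | p <- s, q <- t]; apply/funext => x.
  rewrite big_allpairs_dep/= mulr_suml; apply: eq_bigr => p _.
  rewrite mulr_sumr; apply: eq_bigr => q _.
  by rewrite linearDr expRD; ring.
Qed.

(** In the direction [x - y] the exponents at the two points differ by the positive number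
    [dot (x - y) (x - y)]. *)
Lemma exp_span_separates (x y : H) : x <> y -> exists2 f, exp_span f & f x <> f y.
Proof.
move=> xy; exists (fun z => expR (dot z (x - y))).
  by exists [:: (1, x - y)]; apply/funext => z; rewrite big_seq1 mul1r.
move=> /expR_inj dxy; apply: xy; apply/eqP; rewrite -subr_eq0; apply/eqP.
apply: contrapT => /eqP /(@neq0_dnorm_gt0 _ _ _ dot).
by rewrite dotBl dxy subrr ltxx.
Qed.

Lemma sqr_norm_continuous : continuous (fun x : H => `|x| ^+ 2 : R).
Proof.
move=> x; under eq_fun do rewrite expr2.
by apply: cvgM; exact: norm_continuous.
Qed.

Lemma dot_continuousl (z : H) : continuous (dot ^~ z : H -> R).
Proof.
have -> : dot ^~ z = fun x => (`|x + z| ^+ 2 - `|x| ^+ 2 - `|z| ^+ 2) / 2.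
  apply/funext => x; rewrite -!hdot dotDl !dotDr (dot_sym dot z x).
  by field.
have normc2 (v : H) : continuous (fun x : H => `|x + v| ^+ 2 : R).
  move=> x; under eq_fun do rewrite expr2.
  by apply: cvgM; apply: cvg_norm; apply: cvgD => //; exact: cvg_cst.
move=> x; apply: cvgM; last exact: cvg_cst.
apply: cvgB; last exact: cvg_cst.
apply: cvgB; first exact: normc2.
exact: sqr_norm_continuous.
Qed.

Lemma exp_span_continuous f : exp_span f -> continuous f.
Proof.
move=> [s ->] x; apply: cvg_big => [|p _]; first exact: add_continuous.
apply: cvgMl_tmp; apply: continuous_comp; first exact: dot_continuousl.
exact: continuous_expR.
Qed.

Lemma gauss_weight_gt0 x : 0 < w x.
Proof. exact: expR_gt0. Qed.

(** Multiplying an approximation of [h / w] by [w] thus does not enlarge its error. *)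
Lemma gauss_weight_le1 x : w x <= 1.
Proof. by rewrite -expR0 ler_expR mulNr oppr_le0 mulr_ge0 ?sqr_ge0// ltW. Qed.

Lemma gauss_weightV_continuous : continuous (fun x => (w x)^-1).
Proof.
move=> x; apply: cvgV; first by rewrite gt_eqF// gauss_weight_gt0.
apply: continuous_comp; last exact: continuous_expR.
by apply: cvgMl_tmp; exact: sqr_norm_continuous.
Qed.

Lemma expR_dot_gaussian (x z : H) :
  w x * expR (dot x z) =
  (w ((2 * sigma)^-1 *: z))^-1 * gaussian sigma x ((2 * sigma)^-1 *: z).
Proof.
rewrite gaussian_weight dotZr mulVKf ?gt_eqF ?mulr_gt0//.
by field; rewrite gt_eqF// gauss_weight_gt0.
Qed.

Lemma gaussian_strictly_positive_definite : strictly_positive_definite G.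
Proof.
split; first exact: kernel_quad_positive_definite gaussian_herm kernel_quad_gaussian_ge0.
move=> n x c xinj.
move=> /(kernel_form_eq0 gaussian_herm kernel_quad_gaussian_ge0) c0 i.
(* The relation [c0] concerns kernel sections, and [w * f] is a finite combination of them. *)
have annih f : exp_span f -> \sum_j c j * (w (x j) * f (x j))%:C = 0.
  move=> [s ->].
  under eq_bigr do rewrite mulr_sumr rmorph_sum mulr_sumr.
  rewrite exchange_big big1//= => p _.
  under eq_bigr do rewrite mulrCA expR_dot_gaussian mulrA rmorphM/= mulrCA.
  by rewrite -mulr_sumr c0 mulr0.
have xi : x i \notin [seq x j | j <- enum 'I_n & j != i].
  apply/mapP => -[j]; rewrite mem_filter => /andP[/eqP ji _] /xinj.
  exact/nesym.
(* A test function equal to 1 at [x i] and 0 at the other points isolates [c i * w (x i)]. *)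
have [f Sf [fi fj]] := function_algebra_annihilator exp_span_algebra
  exp_span_separates xi.
have := annih f Sf; rewrite (bigD1 i)//= big1 => [|j ji].
  rewrite addr0 fi mulr1 => /eqP; rewrite mulf_eq0 => /orP[/eqP//|].
  by rewrite eq_complex/= gt_eqF// gauss_weight_gt0.
rewrite fj ?mulr0//; apply/mapP; exists j => //.
by rewrite mem_filter ji mem_enum.
Qed.

(** * Continuity and density in an arbitrary presentation of the space *)

Section Presentation.
Variables (V : completeNormedModType C) (dotV : {dot V for @conjc R}).
Variable (ev : V -> H -> C).
Hypothesis hV : is_rkhs G dotV ev.

Lemma rkhs_ev_cvg (F v : V) (T : Type) (Fl : set_system T) (h : T -> V) :
  Filter Fl -> h @ Fl --> v -> (fun t => dotV F (h t) : C^o) @ Fl --> (dotV F v : C^o).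
Proof.
move=> FF hv; have [hn _ _] := hV.
(* Polarization reduces the claim to continuity of the norm. The second bracket is 2 Im <F, u>,
   because ['i] is conjugated on the right. *)
have polar u : dotV F u = ((`|F + u| ^+ 2 - `|F| ^+ 2 - `|u| ^+ 2) +
    'i * (`|F + 'i *: u| ^+ 2 - `|F| ^+ 2 - `|u| ^+ 2)) / 2.
  have Dl (x y z : V) : dotV (x + y) z = dotV x z + dotV y z by rewrite linearDl.
  have Dr (x y z : V) : dotV x (y + z) = dotV x y + dotV x z by rewrite linearDr.
  have Zl (x y : V) : dotV ('i *: x) y = 'i * dotV x y by rewrite linearZl_LR.
  have Zr (x y : V) : dotV x ('i *: y) = - ('i * dotV x y).
    rewrite linearZr_LR -mulNr; congr (_ * _).
    by apply/eqP; rewrite eq_complex/= oppr0 !eqxx.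
  rewrite -!hn !Dl !Dr !(Zl, Zr) mulrN mulrA.
  have ii : 'i * 'i = -1 :> C by rewrite -expr2 sqr_i.
  rewrite ii; apply: (@mulIf _ 2) => //; rewrite divfK//.
  rewrite !mulrDr !mulrN !mulrA ii; ring.
have sqn (u : V) (f : T -> V) : f @ Fl --> u -> (fun t => `|f t| ^+ 2 : C^o) @ Fl --> (`|u| ^+ 2 : C^o).
  move=> fu; under eq_fun do rewrite expr2; rewrite expr2.
  by apply: cvgM; apply: cvg_norm.
under eq_fun do rewrite polar; rewrite polar.
apply: cvgM; last exact: cvg_cst.
apply: cvgD; last apply: cvgMl_tmp.
  apply: cvgB; last exact: sqn.
  by apply: cvgB; [apply: sqn; apply: cvgD => //; exact: cvg_cst|exact: cvg_cst].
apply: cvgB; last exact: sqn.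
apply: cvgB; last exact: cvg_cst.
apply: sqn; apply: cvgD; first exact: cvg_cst.
exact: cvgZl_tmp.
Qed.

(** By the reproducing property it is enough that [k] is continuous, and the squared distance from
    [k x] to [k y] is 2 (1 - G(x, y)). *)
Lemma rkhs_ev_continuous (F : V) : continuous (ev F : H -> C^o).
Proof.
have [hn _ [k [kE kdot _]]] := hV => x.
have -> : ev F = fun y => dotV F (k y) by apply/funext => y; rewrite kdot.
apply: (@rkhs_ev_cvg F (k x) _ (nbhs x) k); apply/cvgrPdist_lt => _ /gt0_complex[e e0 ->].
have G1 (z : H) : gaussian sigma z z = 1.
  by rewrite /gaussian subrr normr0 expr0n mulr0 expR0.
have kk y : `|k x - k y| ^+ 2 = (2 * (1 - gaussian sigma x y))%:C.
  rewrite -hn linearBl/= !linearBr/= !kdot !kE (gaussian_sym y x).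
  rewrite !G1.
  by apply/eqP; rewrite eq_complex/=; apply/andP; split; apply/eqP; ring.
have Gx : gaussian sigma x y @[y --> x] --> gaussian sigma x x.
  rewrite /gaussian; apply: continuous_cvg; first exact: continuous_expR.
  apply: cvgMl_tmp.
  apply: (@continuous_cvg _ _ _ _ _ (fun y => x - y) (fun z : H => `|z| ^+ 2)); first exact: sqr_norm_continuous.
  by apply: cvgB => //; exact: cvg_cst.
rewrite G1 in Gx.
have e20 : 0 < e ^+ 2 / 2 by rewrite divr_gt0// exprn_gt0.
near=> y.
rewrite -(@ltr_pXn2r _ 2)// ?nnegrE ?ler0c ?(ltW e0)// kk -rmorphXn ltcR.
rewrite mulrC -ltr_pdivlMr// (le_lt_trans (ler_norm _))//; near: y.
exact: cvgr_dist_lt e20.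
Unshelve. all: by end_near. Qed.

Lemma rkhs_exp_span f : exp_span f ->
  exists F : V, forall x, ev F x = (w x * f x)%:C.
Proof.
have [_ [evL _] [k [kE _ _]]] := hV.
move=> [s ->]; elim: s => [|[a z] s [F FE]].
  exists 0 => x; rewrite big_nil mulr0.
  (* Linearity is given for [a *: F + G] only; writing 0 as [-1 *: 0 + 0] yields the value of [ev]
     at 0. *)
  have := evL (-1) 0 0 x; rewrite scaler0 addr0 => ->.
  by rewrite mulN1r addNr.
exists ((a * (w ((2 * sigma)^-1 *: z))^-1)%:C *: k ((2 * sigma)^-1 *: z) + F) => x.
rewrite evL kE FE big_cons mulrDr mulrCA expR_dot_gaussian mulrA.
by rewrite -rmorphM -rmorphD.
Qed.

Lemma rkhs_approximation (A : set H) (g : H -> C^o) (eps : R) :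
  compact A -> {within A, continuous g} -> 0 < eps ->
  exists F : V,
    (ereal_sup [set (normc (ev F x - g x))%:E | x in A] < eps%:E)%E.
Proof.
move=> cA cg e0; have [_ [evL _] _] := hV.
(* In the topology of [subspace A], continuity within [A] becomes plain continuity, so
   Stone-Weierstrass applies without extending [g]. *)
have cA' : compact (A : set (subspace A)).
  by have := compact_subspaceIP A A; rewrite setIid => ->.
(* The real and imaginary parts cost [eps / 3] each; the remaining third makes the inequality strict
   after passing to the supremum. *)
have e30 : 0 < eps / 3 by rewrite divr_gt0.
have approx (h : H -> R) : {within A, continuous h} ->
    exists F : V, forall x, A x -> normc (ev F x - (h x)%:C) <= eps / 3.
  move=> ch.
  have := @stone_weierstrass R (subspace A) A exp_span cA' exp_span_algebra.
  have cs f : exp_span f -> {within A, continuous f}.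
    by move=> Sf; apply: continuous_subspaceT; exact: exp_span_continuous.
  have cwh : {within A, continuous (fun x => (w x)^-1 * h x)}.
    have cw : {within A, continuous (fun x => (w x)^-1)}.
      by apply: continuous_subspaceT; exact: gauss_weightV_continuous.
    by move=> x; apply: cvgM; [exact: cw|exact: ch].
  move=> /(_ cs _ (fun x y _ _ => @exp_span_separates x y) cwh _ e30)[f Sf fh].
  have [F FE] := rkhs_exp_span Sf; exists F => x Ax.
  have -> : ev F x - (h x)%:C = (w x * (f x - (w x)^-1 * h x))%:C.
    by rewrite FE mulrBr mulVKf ?gt_eqF ?gauss_weight_gt0// rmorphB.
  rewrite normc_real normrM gtr0_norm ?gauss_weight_gt0//.
  rewrite -[leRHS]mul1r ler_pM ?gauss_weight_le1 ?(ltW (fh _ Ax))//.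
  exact/ltW/gauss_weight_gt0.
have ReC : continuous (@complex.Re R : C^o -> R).
  move=> z; apply/(@cvgrPdist_lt _ _ _ _ (nbhs_filter (z : C^o))) => d d0.
  apply/nbhs_ballP; exists d%:C => [|y]; first by rewrite /= ltcR.
  rewrite -ball_normE /ball_/= => zy; rewrite -ReN -ReD.
  by rewrite (le_lt_trans (Re_norm_le _))// -ltcR.
have ImC : continuous (@complex.Im R : C^o -> R).
  move=> z; apply/(@cvgrPdist_lt _ _ _ _ (nbhs_filter (z : C^o))) => d d0.
  apply/nbhs_ballP; exists d%:C => [|y]; first by rewrite /= ltcR.
  rewrite -ball_normE /ball_/= => zy; rewrite -ImN -ImD.
  by rewrite (le_lt_trans (Im_norm_le _))// -ltcR.
have [|F1 F1g] := approx (fun x => complex.Re (g x)).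
  by move=> x; apply: continuous_cvg; [exact: ReC|exact: cg].
have [|F2 F2g] := approx (fun x => complex.Im (g x)).
  by move=> x; apply: continuous_cvg; [exact: ImC|exact: cg].
exists ('i *: F2 + F1).
apply: (@le_lt_trans _ _ (eps * (2 / 3))%:E); last by rewrite lte_fin; lra.
apply: ge_ereal_sup => _ [x Ax <-]; rewrite lee_fin evL.
have -> : 'i * ev F2 x + ev F1 x - g x =
    'i * (ev F2 x - (complex.Im (g x))%:C) + (ev F1 x - (complex.Re (g x))%:C).
  have E (z a b p q : C) : z = a + 'i * b -> 'i * p + q - z = 'i * (p - b) + (q - a).
    by move=> ->; ring.
  exact: E (complexE _).
rewrite (le_trans (le_normcD _ _))// Normc.normcM.
have -> : normc 'i = 1 by rewrite /= expr0n expr1n add0r sqrtr1.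
by have := F1g _ Ax; have := F2g _ Ax; lra.
Qed.

End Presentation.

End Gaussian.

Theorem theorem3p1 (R : realType) (H : completeNormedModType R)
    (dot : {dot H for idfun}) (hdot : induces_norm dot)
    (sigma : R) (hsigma : 0 < sigma) :
  strictly_positive_definite (fun x y : H => (gaussian sigma x y)%:C) /\
  universal (fun x y : H => (gaussian sigma x y)%:C).
Proof.
have spd := gaussian_strictly_positive_definite hdot hsigma.
split; first exact: spd.
split; first by case: spd.
  exists (rkhs (fun x y : H => (gaussian sigma x y)%:C)).
  exists (rkhs_dot (@gaussian_herm R H sigma) (kernel_quad_gaussian_ge0 hdot hsigma)).
  by eexists; exact: rkhs_is_rkhs.
move=> V dotV ev hV; split; first exact: rkhs_ev_continuous hV.
by move=> A g eps; exact: (rkhs_approximation hdot hsigma hV).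
Qed.
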